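(* For every instance of the $k$-delete recoverable robust problem under budgeted uncertainty $$(\mathrm{P})\qquad \min_{x\in X}\ f^\top x+\max_{s\in S} R(x,s)$$ and every initial subset of scenarios $S^0\subseteq S$, the column-and-constraint generation algorithm for the scenario-based formulation (described in the context) terminates after finitely many iterations with a globally optimal solution to (P).
   Context: Data: $n\ge 1$ an integer, $N=\{1,\dots,n\}$; $X\subseteq\{0,1\}^n$ nonempty; $f,\bar c,\Delta c\in\mathbb R^n_{\ge 0}$ (first-stage costs, nominal recovery costs, maximal deviations); $\Gamma,k\in\{0,\dots,n\}$. Budgeted uncertainty: $\mathcal U_\Gamma=\{u\in\{0,1\}^n:\sum_{i=1}^n u_i\le\Gamma\}=\{u^1,\dots,u^M\}$. The scenario set is $S=\{1,\dots,M\}$, where scenario $s$ has costs $c_i^s=\bar c_i+\Delta c_i u_i^s$, $i\in N$. Recovery cost: for $x\in X$, $s\in S$, $$R(x,s)=\min_y\Big\{\sum_{i=1}^n c_i^s y_i:\ y\le x,\ \sum_{i=1}^n y_i\ge\sum_{i=1}^n x_i-k,\ y\in\{0,1\}^n\Big\}.$$ Master problem for a set $S^j\subseteq S$: $$(\mathrm{M}_{S^j})\quad \min_{x,y,\eta}\ f^\top x+\eta\ \text{ s.t. }\ \eta\ge\sum_{i=1}^n c_i^s y_i^s,\ \ \sum_{i=1}^n y_i^s\ge\sum_{i=1}^n x_i-k,\ \ x\ge y^s\ (s\in S^j),\ \ x\in X,\ \eta\in\mathbb R_{\ge0},\ y^s\in\{0,1\}^n\ (s\in S^j).$$ Adversarial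 problem for $x\in X$ (a mixed-integer linear reformulation of $\max_{s\in S}R(x,s)$): $$(\mathrm{A}_x)\quad \max_{z,\lambda,\mu}\ \Big(\sum_{i=1}^n x_i-k\Big)\lambda-\sum_{i=1}^n x_i\mu_i\ \text{ s.t. }\ \sum_{i=1}^n z_i\le\Gamma,\ \ \lambda-\mu_i\le\bar c_i+\Delta c_i z_i\ (i\in N),\ \ z\in\{0,1\}^n,\ \mu\in\mathbb R^n_{\ge0},\ \lambda\in\mathbb R_{\ge0}.$$ Algorithm. Input: an instance of (P), a subset $S^0\subseteq S$, and exact solution methods for $(\mathrm{M}_{S^j})$ and $(\mathrm{A}_x)$. Set $L\gets-\infty$, $U\gets+\infty$. For $j=0,1,2,\dots$: 1. Compute an optimal solution $(x^j,y^j,\eta^j)$ to $(\mathrm{M}_{S^j})$ and set $L\gets f^\top x^j+\eta^j$. 2. If $L\ge U$, stop and return $x^j$. 3. Compute an optimal solution $(z^j,\lambda^j,\mu^j)$ to $(\mathrm{A}_{x^j})$ and let $R(x^j)$ denote its optimal objective function value. Set $U\gets\min\{U,\,f^\top x^j+R(x^j)\}$. 4. If $L\ge U$, stop and return $x^j$. 5. Define a new scenario $s$ with $c_i^s=\bar c_i+\Delta c_i z_i^j$ for all $i\in N$ (i.e. $u^s=z^j$), set $S^{j+1}\gets S^j\cup\{s\}$, and continue with iteration $j+1$.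
   Formalization: When L ≥ U holds in step 2, the formal algorithm returns the earlier iterate whose cost equals U, not x^j; returning x^j can be non-optimal when it only ties with that iterate in the master problem. *)

(* Defs.v *)
From HB Require Import structures.
From mathcomp Require Import all_boot all_order all_algebra.
From mathcomp Require Import constructive_ereal reals.
Set Implicit Arguments.
Unset Strict Implicit.
Unset Printing Implicit Defensive.
Import Order.TTheory GRing.Theory Num.Theory.
Local Open Scope ring_scope.

Notation bvec n := {ffun 'I_n -> bool}.

Record instance (R : realType) (n : nat) := Instance {
  solutions : {set bvec n};      (* X *)
  first_cost : 'I_n -> R;        (* f *)
  nominal_cost : 'I_n -> R;      (* \bar c *)
  deviation : 'I_n -> R;         (* \Delta c *)
  budget : nat;                  (* \Gamma *)
  deletions : nat;               (* k *)
  solutions_neq0 : solutions != set0;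
  first_cost_ge0 : forall i, 0 <= first_cost i;
  nominal_cost_ge0 : forall i, 0 <= nominal_cost i;
  deviation_ge0 : forall i, 0 <= deviation i;
  budget_le : (budget <= n)%N;
  deletions_le : (deletions <= n)%N }.

Section Problem.
Context {R : realType} {n : nat} (P : instance R n).

Definition first_stage (x : bvec n) : R :=
  \sum_(i < n) first_cost P i * (x i)%:R.

(* A scenario s is identified with its deviation vector u^s, so the index set
   S = {1, ..., M} is the set of budgeted 0/1 vectors itself. *)
Definition scenarios : {set bvec n} :=
  [set u : bvec n | (\sum_(i < n) u i <= budget P)%N].

Definition scenario_cost (u : bvec n) (i : 'I_n) : R :=
  nominal_cost P i + deviation P i * (u i)%:R.

Definition second_stage (u y : bvec n) : R :=
  \sum_(i < n) scenario_cost u i * (y i)%:R.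

Definition recovery (x y : bvec n) : bool :=
  [forall i, (y i <= x i)%N] &&
  (\sum_(i < n) x i <= \sum_(i < n) y i + deletions P)%N.

(* R(x, u); the minimum is over a nonempty set, since [recovery x x]. *)
Definition recovery_cost (x u : bvec n) : R :=
  second_stage u [arg min_(y < x | recovery x y) second_stage u y]%O.

(* The maximum is over a nonempty set, since the zero vector is a scenario. *)
Definition worst_recovery_cost (x : bvec n) : R :=
  recovery_cost x
    [arg max_(u > ([ffun=> false] : bvec n) in scenarios) recovery_cost x u]%O.

Definition robust_cost (x : bvec n) : R :=
  first_stage x + worst_recovery_cost x.

Definition robust_optimal (x : bvec n) : Prop :=
  x \in solutions P /\
  forall x', x' \in solutions P -> robust_cost x <= robust_cost x'.

(* The components [y s] with s outside T are unconstrained and irrelevant. *)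
Definition master_feasible (T : {set bvec n})
    (x : bvec n) (y : bvec n -> bvec n) (eta : R) : Prop :=
  [/\ x \in solutions P, 0 <= eta &
      forall s, s \in T -> second_stage s (y s) <= eta /\ recovery x (y s)].

Definition master_value (x : bvec n) (eta : R) : R := first_stage x + eta.

Definition master_optimal (T : {set bvec n})
    (x : bvec n) (y : bvec n -> bvec n) (eta : R) : Prop :=
  master_feasible T x y eta /\
  forall x' y' eta', master_feasible T x' y' eta' ->
    master_value x eta <= master_value x' eta'.

Definition adversary_feasible (z : bvec n) (lambda : R) (mu : 'I_n -> R) : Prop :=
  [/\ (\sum_(i < n) z i <= budget P)%N, 0 <= lambda, forall i, 0 <= mu i &
      forall i, lambda - mu i <= nominal_cost P i + deviation P i * (z i)%:R].

Definition adversary_value (x : bvec n) (lambda : R) (mu : 'I_n -> R) : R :=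
  (\sum_(i < n) (x i)%:R - (deletions P)%:R) * lambda
  - \sum_(i < n) (x i)%:R * mu i.

Definition adversary_optimal (x z : bvec n) (lambda : R) (mu : 'I_n -> R) : Prop :=
  adversary_feasible z lambda mu /\
  forall z' lambda' mu', adversary_feasible z' lambda' mu' ->
    adversary_value x lambda' mu' <= adversary_value x lambda mu.

(* The data at the start of an iteration: the scenario set S^j, the bound U,
   and the incumbent, i.e. the iterate whose cost is U.  The bound L is
   recomputed at the start of every iteration, hence is not stored. *)
Record state := State {
  active : {set bvec n};
  upper : \bar R;
  incumbent : option (bvec n) }.

Definition initial_state (S0 : {set bvec n}) : state := State S0 +oo%E None.

Definition adversary_cost (x : bvec n) (lambda : R) (mu : 'I_n -> R) : R :=
  first_stage x + adversary_value x lambda mu.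

Definition new_upper (st : state) (x : bvec n) (lambda : R) (mu : 'I_n -> R) : \bar R :=
  Order.min (upper st) (adversary_cost x lambda mu)%:E.

Definition new_incumbent (st : state) (x : bvec n) (lambda : R) (mu : 'I_n -> R) :=
  if ((adversary_cost x lambda mu)%:E < upper st)%E then Some x else incumbent st.

Inductive outcome := Return of bvec n | Continue of state.

(* [iteration st o]: for some optimal solutions of the two subproblems, the
   iteration started in [st] ends with [o].

   When the test L >= U succeeds before the adversarial problem is solved, U
   is the cost of an earlier iterate, and it is this incumbent that is
   returned.  The current master solution x need not be optimal then, as it
   may only tie with the incumbent on the active scenarios: take n = 2,
   X = {(1,0), (0,1)}, f = (0,1), \bar c = (0,0), \Delta c = (1,1),
   \Gamma = 1, k = 0, no initial scenario, and x = (0,1) in the second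
   iteration, where L = U = 1 but x costs 2.
   When the test succeeds after the adversarial problem is solved, U has just
   decreased, so that the current x is the new incumbent. *)
Inductive iteration (st : state) : outcome -> Prop :=
| StopAfterMaster x y eta xbest of
    master_optimal (active st) x y eta &
    (upper st <= (master_value x eta)%:E)%E &
    incumbent st = Some xbest :
    iteration st (Return xbest)
| StopAfterAdversary x y eta z lambda mu of
    master_optimal (active st) x y eta &
    ((master_value x eta)%:E < upper st)%E &
    adversary_optimal x z lambda mu &
    (new_upper st x lambda mu <= (master_value x eta)%:E)%E :
    iteration st (Return x)
| NextIteration x y eta z lambda mu of
    master_optimal (active st) x y eta &
    ((master_value x eta)%:E < upper st)%E &
    adversary_optimal x z lambda mu &
    ((master_value x eta)%:E < new_upper st x lambda mu)%E :
    iteration st (Continue (State (z |: active st)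
      (new_upper st x lambda mu) (new_incumbent st x lambda mu))).

(* [run S0 st j]: an execution reaches iteration j, passing through the states
   st 0, ..., st j. *)
Definition run (S0 : {set bvec n}) (st : nat -> state) (j : nat) : Prop :=
  st 0%N = initial_state S0 /\
  forall i, (i < j)%N -> iteration (st i) (Continue (st i.+1)).

End Problem.

(* Main.v *)
Require Import Defs.
From HB Require Import structures.
From mathcomp Require Import all_boot all_order all_algebra.
From mathcomp Require Import constructive_ereal reals.
Import Order.TTheory GRing.Theory Num.Theory.
Local Open Scope ring_scope.

(** The adversarial problem is exact, by linear programming duality.  For a
    fixed scenario z, keeping at least |x| - k items of x at least cost is a
    greedy selection, and the cost lambda of the last selected item (0 if
    none has to be kept) together with mu_i = max(0, lambda - c_i) is a dual
    solution of the same value ([strong_duality]).  With weak duality, an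
    optimal (z, lambda, mu) has value max_s R(x, s), and z is a worst scenario
    for x ([adversary_optimalP]).

    Correctness is then a comparison of bounds.  A master problem has only
    some of the scenarios, so its value L is at most the robust cost of every
    solution ([master_optimal_le]), while U is the robust cost of the
    incumbent.  Hence L >= U makes the incumbent optimal.

    Termination holds because each continued iteration adds a scenario that
    was absent.  If z were already active for the master solution x, then eta
    would be at least R(x, z) = max_s R(x, s), thus L would be at least the
    robust cost of x and the second test would have stopped the algorithm
    ([adversary_new]).  There are finitely many 0/1 vectors, which bounds the
    number of iterations. *)

(** * Greedy selection *)

(** Greedy selection of m cheapest elements, with the threshold cost that
    separates them from the others.  The threshold 0 for an empty selection is
    the complementary slackness of the dual variable lambda with the
    cardinality constraint, which can be strict only then. *)
Lemma cheapest_subset (R : realType) (I : finType) (c : I -> R) (X : {set I})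
    (m : nat) : (forall i, 0 <= c i) -> (m <= #|X|)%N ->
  exists A : {set I}, exists lambda : R,
    [/\ A \subset X /\ #|A| = m, 0 <= lambda /\ (m = 0%N -> lambda = 0),
        forall i, i \in A -> c i <= lambda &
        forall i, i \in X :\: A -> lambda <= c i].
Proof.
move=> c_ge0; elim: m => [|m IHm] le_mX.
  exists set0, 0; split=> // [|i]; last by rewrite inE.
  by rewrite sub0set cards0.
have [A [lambda [[sAX cardA] [lambda_ge0 _] leA geA]]] := IHm (ltnW le_mX).
have /card_gt0P[i0 i0P] : (0 < #|X :\: A|)%N.
  by rewrite cardsD (setIidPr sAX) cardA subn_gt0.
case: (arg_minP c i0P) => j jP minj.
have /setDP[jX jA] : j \in X :\: A := jP.
exists (j |: A), (c j); split=> //.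
- by rewrite subUset sub1set jX sAX cardsU1 jA cardA.
- by move=> i /setU1P[->//|iA]; apply: le_trans (leA _ iA) (geA _ jP).
- move=> i; rewrite !inE negb_or -andbA => /and3P[_ iA iX].
  by apply: minj; apply/setDP; split.
Qed.

Section Algorithm.
Context {R : realType} {n : nat} (P : instance R n).
Implicit Types (x z u s : bvec n) (T : {set bvec n}).
Implicit Types (eta lambda : R) (mu : 'I_n -> R).

(** * Recovery costs *)

Lemma scenario_cost_ge0 u i : 0 <= scenario_cost P u i.
Proof.
by rewrite addr_ge0 ?nominal_cost_ge0 // mulr_ge0 ?deviation_ge0 ?ler0n.
Qed.

Lemma second_stage_ge0 u y : 0 <= second_stage P u y.
Proof. by apply: sumr_ge0 => i _; rewrite mulr_ge0 ?scenario_cost_ge0. Qed.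

Lemma recovery_refl x : recovery P x x.
Proof. by rewrite /recovery leq_addr andbT; apply/forallP => i. Qed.

Lemma recovery_cost_attained x u :
  exists2 y, recovery P x y & recovery_cost P x u = second_stage P u y.
Proof.
rewrite /recovery_cost; case: (arg_minP _ (recovery_refl x)) => y ry _.
by exists y.
Qed.

Lemma recovery_cost_le x u y :
  recovery P x y -> recovery_cost P x u <= second_stage P u y.
Proof.
move=> ry; rewrite /recovery_cost.
by case: (arg_minP _ (recovery_refl x)) => y' _; apply.
Qed.

Lemma recovery_cost_ge0 x u : 0 <= recovery_cost P x u.
Proof. by have [y _ ->] := recovery_cost_attained x u; apply: second_stage_ge0. Qed.

Lemma scenario0 : [ffun=> false] \in scenarios P.
Proof. by rewrite inE big1 // => i _; rewrite ffunE. Qed.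

Lemma worst_recovery_cost_attained x :
  exists2 u, u \in scenarios P & worst_recovery_cost P x = recovery_cost P x u.
Proof.
rewrite /worst_recovery_cost; case: (arg_maxP _ scenario0) => u uS _.
by exists u.
Qed.

Lemma worst_recovery_cost_ge x u :
  u \in scenarios P -> recovery_cost P x u <= worst_recovery_cost P x.
Proof.
move=> uS; rewrite /worst_recovery_cost.
by case: (arg_maxP _ scenario0) => u' _; apply.
Qed.

(** * Exactness of the adversarial problem *)

Lemma weak_duality x y z lambda mu :
  adversary_feasible P z lambda mu -> recovery P x y ->
  adversary_value P x lambda mu <= second_stage P z y.
Proof.
move=> [_ lambda_ge0 mu_ge0 dual] /andP[/forallP le_yx card_y].
have {}card_y : \sum_(i < n) (x i)%:R - (deletions P)%:R
    <= \sum_(i < n) (y i)%:R :> R.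
  by rewrite lerBlDr -!natr_sum -natrD ler_nat.
apply: (@le_trans _ _ (\sum_(i < n) (lambda - mu i) * (y i)%:R)); last first.
  by apply: ler_sum => i _; apply: ler_wpM2r; rewrite ?ler0n.
rewrite (eq_bigr _ (fun i _ => mulrBl _ _ _)) sumrB -mulr_sumr.
rewrite /adversary_value lerB //.
  by rewrite mulrC ler_wpM2l.
by apply: ler_sum => i _; rewrite mulrC ler_wpM2r ?ler_nat ?le_yx.
Qed.

(** The items of x split into the selected ones, of cost c_i <= lambda, where
    mu_i = lambda - c_i, and the others, where mu_i = 0.  So the dual value is
    lambda times the number of selected items, minus the sum of the
    lambda - c_i over them: the cost of the selection. *)
Lemma strong_duality x z : z \in scenarios P ->
  exists lambda, exists mu, adversary_feasible P z lambda mu /\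
    adversary_value P x lambda mu = recovery_cost P x z.
Proof.
move=> zS; pose X := [set i | x i].
have sum_set (A : {set 'I_n}) :
    (\sum_(i < n) (i \in A))%N = #|A|.
  by rewrite -sum1_card [RHS]big_mkcond; apply: eq_bigr => i _; case: (i \in A).
have cardX : (\sum_(i < n) x i)%N = #|X|.
  by rewrite -sum_set; apply: eq_bigr => i _; rewrite inE.
have [A [lambda [[sAX cardA] [lambda_ge0 slack] leA geA]]] :=
  cheapest_subset _ _ (scenario_cost P z) _ _ (scenario_cost_ge0 z)
    (leq_subr (deletions P) #|X|).
pose mu i := Num.max 0 (lambda - scenario_cost P z i).
pose y : {ffun 'I_n -> bool} := [ffun i => i \in A].
have feas : adversary_feasible P z lambda mu.
  split=> // [|i|i]; first by rewrite inE in zS.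
    by rewrite le_max lexx.
  by rewrite lerBlDr addrC -lerBlDr le_max lexx orbT.
have ry : recovery P x y.
  apply/andP; split.
    apply/forallP=> i; rewrite ffunE; case: (boolP (i \in A)) => // /(subsetP sAX).
    by rewrite inE => ->.
  rewrite cardX (eq_bigr (fun i => nat_of_bool (i \in A))); last first.
    by move=> i _; rewrite ffunE.
  by rewrite sum_set cardA addnC -leq_subLR.
exists lambda, mu; split=> //.
have value_y : adversary_value P x lambda mu = second_stage P z y.
  have slackE : (\sum_(i < n) (x i)%:R - (deletions P)%:R) * lambda
      = \sum_(i < n) (i \in A)%:R * lambda.
    rewrite -mulr_suml -!natr_sum cardX sum_set cardA.
    (* If k > |x|, the truncated |x| - k differs from the signed one in the
       dual objective, but then it is 0 and so is lambda. *)
    case: (leqP (deletions P) #|X|) => [le_kX | /ltnW]; first by rewrite natrB.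
    by rewrite -subn_eq0 => /eqP/slack->; rewrite !mulr0.
  rewrite /adversary_value slackE -sumrB; apply: eq_bigr => i _.
  rewrite ffunE; case: (boolP (i \in A)) => iA.
    have := subsetP sAX i iA; rewrite inE => ->.
    by rewrite !mul1r mulr1 /mu max_r ?subr_ge0 ?leA // subKr.
  rewrite mul0r mulr0 sub0r; case xi: (x i); last by rewrite mul0r oppr0.
  by rewrite /mu max_l ?mulr0 ?oppr0 // subr_le0 geA // !inE iA xi.
apply/le_anti/andP; split.
  by have [y' ry' ->] := recovery_cost_attained x z; apply: weak_duality.
by rewrite value_y recovery_cost_le.
Qed.

(** By strong duality at the worst scenario, the optimal value is at least
    max_s R(x, s); by weak duality at z, it is at most R(x, z). *)
Lemma adversary_optimalP x z lambda mu :
  adversary_optimal P x z lambda mu ->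
  [/\ z \in scenarios P,
      adversary_cost P x lambda mu = robust_cost P x &
      worst_recovery_cost P x = recovery_cost P x z].
Proof.
move=> [feas opt]; have zS : z \in scenarios P by rewrite inE; case: feas.
have le_z : adversary_value P x lambda mu <= recovery_cost P x z.
  have [y ry ->] := recovery_cost_attained x z.
  exact: weak_duality.
have ge_worst : worst_recovery_cost P x <= adversary_value P x lambda mu.
  have [u uS ->] := worst_recovery_cost_attained x.
  by have [l [m [feas' <-]]] := strong_duality x u uS; apply: opt feas'.
have le_worst := worst_recovery_cost_ge x z zS.
split=> //; last by apply/le_anti; rewrite le_worst (le_trans ge_worst).
congr (_ + _); apply/le_anti.
by rewrite ge_worst (le_trans le_z).
Qed.

Lemma adversary_optimal_exists x :
  exists z lambda mu, adversary_optimal P x z lambda mu.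
Proof.
have [z zS worstE] := worst_recovery_cost_attained x.
have [lambda [mu [feas valE]]] := strong_duality x z zS.
exists z, lambda, mu; split=> // z' lambda' mu' feas'.
rewrite valE -worstE.
have z'S : z' \in scenarios P by rewrite inE; case: feas'.
apply: le_trans (worst_recovery_cost_ge x z' z'S).
have [y ry ->] := recovery_cost_attained x z'.
exact: weak_duality.
Qed.

(** * Master problems as relaxations *)

Lemma master_feasible_recovery_cost T x y eta s :
  master_feasible P T x y eta -> s \in T -> recovery_cost P x s <= eta.
Proof.
move=> [_ _ rec] /rec[le_eta ry].
by apply: le_trans le_eta; apply: recovery_cost_le.
Qed.

(** For fixed x, the recoveries of distinct scenarios are coupled only through
    eta, so taking an optimal one in each scenario suffices. *)
Lemma master_feasible_intro T x eta :
  x \in solutions P -> 0 <= eta ->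
  (forall s, s \in T -> recovery_cost P x s <= eta) ->
  exists y, master_feasible P T x y eta.
Proof.
move=> xX eta_ge0 le_eta.
exists (fun s => [arg min_(y < x | recovery P x y) second_stage P s y]%O).
split=> // s /le_eta; rewrite /recovery_cost => le_s; split=> //.
by case: (arg_minP _ (recovery_refl x)).
Qed.

Lemma master_optimal_le T x y eta x' :
  T \subset scenarios P -> master_optimal P T x y eta ->
  x' \in solutions P -> master_value P x eta <= robust_cost P x'.
Proof.
move=> sTS [_ opt] x'X.
have [|s /(subsetP sTS)|y' feas] :=
    master_feasible_intro T x' (worst_recovery_cost P x') x'X.
- by have [u _ ->] := worst_recovery_cost_attained x'; apply: recovery_cost_ge0.
- exact: worst_recovery_cost_ge.
- exact: opt feas.
Qed.

Lemma master_optimal_exists T :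
  exists x y eta, master_optimal P T x y eta.
Proof.
pose best x := \big[Num.max/0]_(s in T) recovery_cost P x s.
have [x0 x0X] := set0Pn _ (solutions_neq0 P).
case: (arg_minP (fun x => first_stage P x + best x) x0X) => x xX minx.
have [||y feas] := master_feasible_intro T x (best x) xX.
- by rewrite /best; exact: bigmax_ge_id.
- by move=> s sT; rewrite /best; exact: le_bigmax_cond.
exists x, y, (best x); split=> // x' y' eta' feas'.
have [x'X eta'_ge0 _] := feas'.
apply: le_trans (minx x' x'X) _; rewrite lerD2l.
by apply: bigmax_le => // s; apply: master_feasible_recovery_cost feas'.
Qed.

(** * Iterations *)

Lemma adversary_new T x y eta z lambda mu :
  master_feasible P T x y eta -> adversary_optimal P x z lambda mu ->
  master_value P x eta < adversary_cost P x lambda mu -> z \notin T.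
Proof.
move=> feas /adversary_optimalP[_ -> worstE]; apply: contraTN => zT.
rewrite -leNgt /robust_cost worstE lerD2l.
exact: master_feasible_recovery_cost feas zT.
Qed.

(** What the stopping tests rely on: the active set consists of genuine
    scenarios, so that L is a lower bound, and a finite U comes with an
    incumbent of that cost, which can be returned. *)
Definition state_invariant (st : state) : Prop :=
  active st \subset scenarios P /\
  match incumbent st with
  | None => upper st = +oo%E
  | Some x => x \in solutions P /\ upper st = (robust_cost P x)%:E
  end.

Lemma initial_invariant (S0 : {set bvec n}) :
  S0 \subset scenarios P -> state_invariant (initial_state S0).
Proof. by split. Qed.

Lemma iteration_invariant st st' :
  state_invariant st -> iteration P st (Continue st') -> state_invariant st'.
Proof.
move=> [sTS inv] it; inversion it as [| |x y eta z lambda mu [[xX _ _] _] _ adv _ E].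
have [zS costE _] := adversary_optimalP _ _ _ _ adv.
split=> /=; first by rewrite subUset sub1set zS.
rewrite /new_incumbent /new_upper costE.
by case: ltP.
Qed.

Lemma iteration_active st st' :
  iteration P st (Continue st') -> (#|active st| < #|active st'|)%N.
Proof.
move=> it; inversion it as [| |x y eta z lambda mu [feas _] _ adv lt_L E] => /=.
rewrite cardsU1 (adversary_new _ _ _ _ _ _ _ feas adv) //.
by move: lt_L; rewrite /new_upper lt_min lte_fin => /andP[].
Qed.

Lemma iteration_exists st : state_invariant st -> exists o, iteration P st o.
Proof.
move=> [_ inv]; have [x [y [eta opt]]] := master_optimal_exists (active st).
case: (leP (upper st) (master_value P x eta)%:E) => [le_U | lt_L].
  case incE: (incumbent st) inv => [x'|] inv.
    by exists (Return x'); exact: StopAfterMaster opt le_U incE.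
  by rewrite inv in le_U.
have [z [lambda [mu adv]]] := adversary_optimal_exists x.
case: (leP (new_upper P st x lambda mu) (master_value P x eta)%:E) => [le_U' | lt_L'].
  by exists (Return x); exact: StopAfterAdversary opt lt_L adv le_U'.
by eexists; exact: NextIteration opt lt_L adv lt_L'.
Qed.

Lemma iteration_return st x :
  state_invariant st -> iteration P st (Return x) -> robust_optimal P x.
Proof.
move=> [sTS inv] it.
inversion it as [x' y eta xbest opt le_U incE E
  |x' y eta z lambda mu opt lt_L adv le_U E|].
  subst xbest; move: inv; rewrite incE => -[xX UE]; split=> // x'' x''X.
  apply: le_trans (master_optimal_le _ _ _ _ _ sTS opt x''X).
  by rewrite -lee_fin -UE.
subst x'; have [_ costE _] := adversary_optimalP _ _ _ _ adv.
split=> [|x'' x''X]; first by case: opt => -[].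
apply: le_trans (master_optimal_le _ _ _ _ _ sTS opt x''X).
(* U was above L before the update, so it is the cost of x that makes the
   test succeed. *)
by move: le_U; rewrite /new_upper ge_min leNgt lt_L /= lee_fin costE.
Qed.

Lemma run_invariant (S0 : {set bvec n}) st j :
  S0 \subset scenarios P -> run P S0 st j -> state_invariant (st j).
Proof.
move=> S0S [st0 step].
have inv i : (i <= j)%N -> state_invariant (st i).
  elim: i => [_|i IHi lt_ij]; first by rewrite st0; exact: initial_invariant.
  exact: iteration_invariant (IHi (ltnW lt_ij)) (step i lt_ij).
exact: inv.
Qed.

Lemma run_active S0 st j : run P S0 st j -> (j <= #|active (st j)|)%N.
Proof.
move=> [_ step].
have le_active i : (i <= j)%N -> (i <= #|active (st i)|)%N.
  elim: i => // i IHi lt_ij; apply: leq_ltn_trans (IHi (ltnW lt_ij)) _.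
  exact: iteration_active (step i lt_ij).
exact: le_active.
Qed.

End Algorithm.

Theorem theorem4 (R : realType) (n : nat) (n_ge1 : (1 <= n)%N)
    (P : instance R n) (S0 : {set {ffun 'I_n -> bool}})
    (S0_sub : S0 \subset scenarios P) :
  [/\ (* no execution goes on forever *)
      ~ (exists st : nat -> state, forall j, run P S0 st j),
      (* no execution gets stuck *)
      (forall st j, run P S0 st j -> exists o, iteration P (st j) o) &
      (* what is returned is a global optimum *)
      (forall st j x, run P S0 st j -> iteration P (st j) (Return x) ->
        robust_optimal P x)].
Proof.
split=> [[st runs] | st j /(run_invariant _ _ _ _ S0_sub) | st j x].
- pose m := #|{ffun 'I_n -> bool}|.
  have := leq_trans (run_active _ _ _ _ (runs m.+1)) (max_card _).
  by rewrite ltnn.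
- exact: iteration_exists.
- by move/(run_invariant _ _ _ _ S0_sub); exact: iteration_return.
Qed.
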